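(* Let $(G,\mathcal{C})$ be a 2-colored graph, $G=(V,E)$. Then: (i) the extreme rays of the alternating cone $\mathcal{A}(G,\mathcal{C})$ are (the rays spanned by) the characteristic vectors of the alternating cycles and the alternating bicycles in $(G,\mathcal{C})$; (ii) every integral vector in $\mathcal{A}(G,\mathcal{C})$ is a nonnegative integral combination of characteristic vectors of irreducible CAW's; (iii) every $\{0,1\}$-vector in $\mathcal{A}(G,\mathcal{C})$ is a nonnegative integral combination of characteristic vectors of irreducible CAT's; (iv) the characteristic vector of an irreducible CAW is $\{0,1,2\}$-valued.
   Context: Graphs are finite, undirected, may have parallel edges but no loops. A 2-colored graph $(G,\mathcal{C})$ is a graph $G=(V,E)$ with a coloring $\mathcal{C}:E\to\{R,B\}$ (red/blue). The alternating cone $\mathcal{A}(G,\mathcal{C})\subseteq\mathbb{R}^E$ is the set of $x$ with $x(e)\ge0$ for all $e$ and, at every vertex $v$, $\sum_{e\text{ red},\,e\ni v}x(e)=\sum_{e\text{ blue},\,e\ni v}x(e)$. A walk is a sequence $W=(v_0,e_1,v_1,\dots,e_m,v_m)$, $m\ge0$, with $e_j$ having endpoints $v_{j-1},v_j$; its characteristic vector is $\chi(W)=\sum_{i=1}^m\chi(e_i)$, where $\chi(e)$ is the unit vector of $e$ in $\mathbb{R}^E$. $W$ is closed if $v_0=v_m$; a trail if $e_1,\dots,e_m$ are distinct; a path if moreover $v_0,\dots,v_m$ are distinct; a cycle if closed, edges distinct and $v_0,\dots,v_{m-1}$ distinct. $W$ is internally alternating if $\mathcal{C}(e_j)\ne\mathcal{C}(e_{j+1})$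 for $j=1,\dots,m-1$; alternating if internally alternating and, when closed, also $\mathcal{C}(e_m)\ne\mathcal{C}(e_1)$. A CAW (resp. CAT) is a closed alternating walk (resp. trail). An (even) alternating cycle is a cycle of even length that is alternating. An odd internally alternating cycle with base $v_0$ is a $v_0$-$v_0$ cycle of odd length that is internally alternating. An alternating bicycle is an alternating walk of the form $W_1*P*W_2*P^R$ where $W_1,W_2$ are odd internally alternating cycles, $P$ is a path between their bases (possibly empty if the bases coincide), the internal vertices of $W_1$, $P$, $W_2$ are disjoint, $*$ denotes concatenation and $P^R$ is the reversal of $P$. A CAW $W$ is irreducible if $\chi(W)\ne\chi(W_1)+\chi(W_2)$ for all CAW's $W_1,W_2$; a CAT $T$ is irreducible if $\chi(T)\ne\chi(T_1)+\chi(T_2)$ for all CAT's $T_1,T_2$. *)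

(* Defs.v *)
From HB Require Import structures.
From mathcomp Require Import all_boot all_order all_algebra.
From mathcomp Require Import reals.
Set Implicit Arguments. Unset Strict Implicit. Unset Printing Implicit Defensive.
Import Order.TTheory GRing.Theory Num.Theory.

(* A graph G = (V,E) with parallel edges allowed: E is a finite type of edge
   names and [ends e] gives the two endpoints of e (no loops is a hypothesis
   of the theorem).  A 2-coloring is [col : E -> bool], true = red, false = blue. *)

Section Walks.
Variables (V E : finType) (ends : E -> V * V) (col : E -> bool).

(* A walk (v0,e1,v1,...,em,vm) is represented as (v0, [:: (e1,v1); ...; (em,vm)]). *)
Definition walk := (V * seq (E * V))%type.

Definition joins (e : E) (v w : V) : bool :=
  ((ends e).1 == v) && ((ends e).2 == w) || ((ends e).1 == w) && ((ends e).2 == v).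

Fixpoint walk_from (v : V) (s : seq (E * V)) : bool :=
  if s is (e, w) :: s' then joins e v w && walk_from w s' else true.

Definition is_walk (W : walk) : bool := walk_from W.1 W.2.
Definition wedges (W : walk) : seq E := map fst W.2.
Definition wverts (W : walk) : seq V := W.1 :: map snd W.2.
Definition wlen (W : walk) : nat := size W.2.
Definition wend (W : walk) : V := last W.1 (map snd W.2).

Definition chi (W : walk) (e : E) : nat := count_mem e (wedges W).

Definition closedw (W : walk) : bool := wend W == W.1.
Definition trailw (W : walk) : bool := is_walk W && uniq (wedges W).
Definition pathw (W : walk) : bool := trailw W && uniq (wverts W).
Definition cyclew (W : walk) : bool :=
  [&& is_walk W, closedw W, 0 < wlen W, uniq (wedges W)
    & uniq (take (wlen W) (wverts W))].

Definition int_alt (W : walk) : bool := sorted (fun e f => col e != col f) (wedges W).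
Definition altw (W : walk) : bool :=
  int_alt W &&
  (if wedges W is e1 :: es then closedw W ==> (col (last e1 es) != col e1) else true).

Definition caw (W : walk) : bool := [&& is_walk W, closedw W, 0 < wlen W & altw W].
Definition catw (W : walk) : bool := caw W && uniq (wedges W).

Definition irr_caw (W : walk) : Prop :=
  caw W /\ ~ exists W1 W2, [/\ caw W1, caw W2 & forall e, chi W e = chi W1 e + chi W2 e].
Definition irr_cat (W : walk) : Prop :=
  catw W /\ ~ exists W1 W2, [/\ catw W1, catw W2 & forall e, chi W e = chi W1 e + chi W2 e].

Definition alt_cycle (W : walk) : bool := [&& cyclew W, ~~ odd (wlen W) & altw W].
Definition odd_ia_cycle (W : walk) : bool := [&& cyclew W, odd (wlen W) & int_alt W].

Definition wrev (W : walk) : walk :=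
  (wend W, zip (rev (wedges W)) (behead (rev (wverts W)))).
Definition wcat (W1 W2 : walk) : walk := (W1.1, W1.2 ++ W2.2).

Definition cyc_int (W : walk) : seq V := behead (take (wlen W) (wverts W)).

Definition alt_bicycle (W : walk) : Prop :=
  exists W1 P W2,
    [/\ odd_ia_cycle W1, odd_ia_cycle W2 & pathw P] /\
    [/\ P.1 = W1.1, wend P = W2.1,
        uniq (cyc_int W1 ++ wverts P ++ cyc_int W2),
        W = wcat (wcat (wcat W1 P) W2) (wrev P)
      & altw W].

Local Open Scope ring_scope.
Definition incident (e : E) (v : V) : bool := ((ends e).1 == v) || ((ends e).2 == v).

Definition in_cone (R : numDomainType) (x : E -> R) : Prop :=
  (forall e, 0 <= x e) /\
  forall v, \sum_(e | incident e v && col e) x e = \sum_(e | incident e v && ~~ col e) x e.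

Definition extreme_gen (R : numDomainType) (x : E -> R) : Prop :=
  [/\ in_cone x, exists e, x e != 0 &
      forall y z : E -> R, in_cone y -> in_cone z -> (forall e, x e = y e + z e) ->
        exists2 a : R, 0 <= a & forall e, y e = a * x e].

End Walks.

(* Main.v *)
(* Alternating walks have balanced characteristic vectors because the signed
   vertex-edge incidences (+1 red, -1 blue) telescope along them.  Conversely, an
   alternating walk below a balanced vector x can be prolonged inside x until it
   is a closed alternating walk; subtracting and splitting gives (ii) and (iii).
   An irreducible CAW never traverses an edge twice in the same direction (cut it
   there), which gives (iv).

   For (i), grow an alternating path in the support of a cone element until it
   hits itself.  The loop is an alternating cycle or an odd one; in the latter
   case grow a second alternating path out of the base of the odd loop until it
   hits itself or the loop, which yields an alternating cycle or a bicycle W.  On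
   an extreme ray, x - l chi(W) stays in the cone for small l > 0, so x is
   proportional to chi(W).  Conversely a balanced vector supported on a cycle or
   bicycle is constant along each of its cycles and its connecting path, since
   interior vertices meet just two of its edges, and balance at the bases fixes
   the ratio 1 : 2 : 1. *)
Require Import Defs.
From HB Require Import structures.
From mathcomp Require Import all_boot all_order all_algebra.
From mathcomp Require Import boolp reals.
From mathcomp Require Import zify ring lra.
Set Implicit Arguments. Unset Strict Implicit. Unset Printing Implicit Defensive.
Import Order.TTheory GRing.Theory Num.Theory.

Section Walks.
Variables (V E : finType) (ends : E -> V * V) (col : E -> bool).
Hypothesis noloop : forall e, (ends e).1 != (ends e).2.

Notation walk_from := (walk_from ends).
Notation joins := (joins ends).
Notation incident := (incident ends).
Implicit Types (e f g : E) (u v w z : V) (s p q r : seq (E * V)) (c : bool).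

(** * Walks and alternating colour sequences *)

Lemma joinsC e v w : joins e v w = joins e w v.
Proof. by rewrite /Defs.joins orbC. Qed.

Lemma joins_neq e v w : joins e v w -> v != w.
Proof.
by case/orP=> /andP[/eqP<- /eqP<-]; rewrite // eq_sym.
Qed.

Lemma joins_incident e v w t : joins e v w -> incident e t = (t == v) || (t == w).
Proof.
by rewrite /Defs.incident; case/orP=> /andP[/eqP-> /eqP->]; rewrite ![_ == t]eq_sym // orbC.
Qed.

Lemma incident_joins e v : incident e v -> exists w, joins e v w.
Proof.
rewrite /Defs.incident /Defs.joins; case/orP=> /eqP->.
  by exists (ends e).2; rewrite !eqxx.
by exists (ends e).1; rewrite !eqxx orbT.
Qed.

Lemma walk_from_cat v p q :
  walk_from v (p ++ q) = walk_from v p && walk_from (last v (map snd p)) q.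
Proof. by elim: p v => [|[e w] p IH] v //=; rewrite IH andbA. Qed.

Lemma walk_from_rcons v p e w :
  walk_from v (rcons p (e, w)) = walk_from v p && joins e (last v (map snd p)) w.
Proof. by rewrite -cats1 walk_from_cat /= andbT. Qed.

(** The first colour is a parameter, so the colour at position [i] is [c (+) odd i] and every colour
    question about concatenations and reversals becomes a parity computation. *)
Fixpoint alternates c (s : seq E) : bool :=
  if s is e :: s' then (col e == c) && alternates (~~ c) s' else true.

Lemma alternates_cat c (s t : seq E) :
  alternates c (s ++ t) = alternates c s && alternates (c (+) odd (size s)) t.
Proof.
elim: s c => [|e s IH] c /=; first by rewrite addbF.
by rewrite IH andbA addbN addNb.
Qed.

Lemma alternates_rcons c (s : seq E) e :
  alternates c (rcons s e) = alternates c s && (col e == c (+) odd (size s)).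
Proof. by rewrite -cats1 alternates_cat /= andbT. Qed.

Lemma alternates_rev c (s : seq E) :
  alternates c s -> alternates (c (+) ~~ odd (size s)) (rev s).
Proof.
elim: s c => [|e s IH] c //= /andP[/eqP <-] /IH.
rewrite rev_cons alternates_rcons size_rev negbK addNb -addbN negbK => -> /=.
by rewrite -addbA addbb addbF.
Qed.

Lemma alternates_last c (s : seq E) e :
  alternates c (e :: s) -> col (last e s) = c (+) odd (size s).
Proof.
by rewrite lastI alternates_rcons size_belast => /andP[_ /eqP].
Qed.

Lemma sorted_alternates e (s : seq E) :
  sorted (fun e f => col e != col f) (e :: s) = alternates (col e) (e :: s).
Proof.
rewrite /= eqxx /=; elim: s e => //= f s IH e; rewrite IH.
by case: (col f) (col e) => [] [].
Qed.

Lemma cawE v s :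
  caw ends col (v, s) <->
  [/\ walk_from v s, last v (map snd s) = v, 0 < size s, ~~ odd (size s)
    & exists c, alternates c (map fst s)].
Proof.
rewrite /caw /is_walk /closedw /wend /wlen /altw /int_alt /wedges /=.
case: s => [|[e w] s]; first by split=> [/and4P[]|[]].
rewrite sorted_alternates; split.
  case/and4P=> Hw /eqP Hc _ /andP[Ha] /implyP/(_ (introT eqP Hc)) Hl; split=> //; last by exists (col e).
  by move: Hl; rewrite (alternates_last Ha) size_map /=; case: (odd _); case: (col e).
case=> Hw Hl _ ev [c Ha]; have ec : col e = c by case/andP: Ha => /eqP.
apply/and4P; split=> //; first exact/eqP; apply/andP; split; rewrite ?ec //; apply/implyP=> _.
by rewrite (alternates_last Ha) size_map; move: ev => /=; rewrite ?ec; case: (odd _); case: c {Ha ec}.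
Qed.

Lemma walk_incident v s e t : walk_from v s -> e \in map fst s -> incident e t ->
  t \in v :: map snd s.
Proof.
elim: s v => [|[f w] s IH] v //= /andP[Hj Hw].
rewrite inE => /predU1P[->|/(IH _ Hw) H] It; last by rewrite inE H ?orbT.
by move: It; rewrite (joins_incident t Hj) !inE orbA => ->.
Qed.

Lemma path_uniq_edges v s : walk_from v s -> uniq (v :: map snd s) -> uniq (map fst s).
Proof.
elim: s v => [|[e w] s IH] v //= /andP[Hj Hw] /andP[Hv Hu].
rewrite (IH w) // andbT; apply/negP => /(walk_incident Hw) H.
by move: Hv; rewrite H // (joins_incident _ Hj) eqxx.
Qed.

(** After the first step the walk is a path, so only the first edge could recur. It cannot recur at
    once, because colours alternate, nor later, because the path has then left [w]. *)
Lemma closed_uniq_edges v s c : walk_from v s -> last v (map snd s) = v ->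
  uniq (map snd s) -> alternates c (map fst s) -> uniq (map fst s).
Proof.
case: s => [|[e w] s] //= /andP[Hj Hw] Hl Hu /andP[/eqP ec Ha].
rewrite (path_uniq_edges Hw Hu) andbT; apply/negP.
case: s Hw Hl Hu Ha => [|[f u] s] //= /andP[Hf Hw] Hl /andP[Hwu Hu] /andP[/eqP fc _].
rewrite inE => /predU1P[eE|]; first by move: fc; rewrite -eE ec; case: (c).
move/(walk_incident Hw) => H; move: Hwu.
by rewrite H // (joins_incident _ Hj) eqxx orbT.
Qed.

(** The hypothesis concerns v_1, ..., v_m while [cyclew] speaks of v_0, ..., v_{m-1}; as v_m = v_0,
    these lists differ by a rotation. *)
Lemma closed_cyclew v s c : walk_from v s -> last v (map snd s) = v -> 0 < size s ->
  uniq (map snd s) -> alternates c (map fst s) -> cyclew ends (v, s).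
Proof.
move=> Hw Hl s0 Hu Ha; rewrite /cyclew /is_walk /closedw /wend /wlen /wedges /wverts /=.
rewrite Hw Hl eqxx s0 (closed_uniq_edges Hw Hl Hu Ha) /=.
case/lastP: s Hl s0 Hu {Hw Ha} => // s [e w]; rewrite map_rcons last_rcons /= => -> _.
rewrite rcons_uniq => /andP[Hv Hu].
by rewrite size_rcons /= -cats1 take_size_cat ?size_map // Hv.
Qed.

Lemma cyclew_rcons v s : cyclew ends (v, s) ->
  exists q e, [/\ s = rcons q (e, v), walk_from v s, uniq (map fst s),
                  uniq (v :: map snd q) & cyc_int (v, s) = map snd q].
Proof.
case/and5P; rewrite /is_walk /closedw /wend /wlen /wedges /wverts /cyc_int /=.
rewrite /wlen /wverts /=; case/lastP: s => // s [e w].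
rewrite !map_rcons last_rcons size_rcons /= -!cats1 !take_size_cat ?size_map // => Hw /eqP wv _ Hu Hv.
rewrite wv cats1 in Hw *; exists s, e; split=> //.
Qed.

Lemma alt_cycleI v s c : walk_from v s -> last v (map snd s) = v -> 0 < size s ->
  ~~ odd (size s) -> uniq (map snd s) -> alternates c (map fst s) -> alt_cycle ends col (v, s).
Proof.
move=> Hw Hl s0 Hev Hu Ha; rewrite /alt_cycle (closed_cyclew Hw Hl s0 Hu Ha) Hev /=.
by have /cawE/and4P[] : [/\ walk_from v s, last v (map snd s) = v, 0 < size s, ~~ odd (size s)
    & exists c, alternates c (map fst s)] by split=> //; exists c.
Qed.

Lemma odd_ia_cycleI v s c : walk_from v s -> last v (map snd s) = v ->
  odd (size s) -> uniq (map snd s) -> alternates c (map fst s) -> odd_ia_cycle ends col (v, s).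
Proof.
move=> Hw Hl Hodd Hu Ha; rewrite /odd_ia_cycle /wlen Hodd.
have s0 : 0 < size s by case: (s) Hodd.
rewrite (closed_cyclew Hw Hl s0 Hu Ha) /= /int_alt /wedges.
case: s Ha {Hw Hl Hodd Hu s0} => // [[e w] s] Ha.
by rewrite map_cons sorted_alternates; move: (Ha) => /= /andP[/eqP-> _]; rewrite eqxx; case/andP: Ha.
Qed.

(** * Reversed walks and the assembly of bicycles *)

Definition rev_steps v s := (wrev (v, s)).2.

Lemma rev_steps_cons v e w s : rev_steps v ((e, w) :: s) = rcons (rev_steps w s) (e, v).
Proof.
rewrite /rev_steps /wrev /wedges /wverts /= !rev_cons.
case: (lastP s) => [|s' [f u]] //; rewrite !map_rcons !rev_rcons /=.
rewrite -rcons_cons -[X in zip X]/(rcons (f :: rev (map fst s')) e) zip_rcons //=.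
by rewrite size_rcons !size_rev !size_map.
Qed.

Lemma rev_stepsP v s : let w := last v (map snd s) in
  [/\ map fst (rev_steps v s) = rev (map fst s),
      w :: map snd (rev_steps v s) = rev (v :: map snd s),
      last w (map snd (rev_steps v s)) = v
    & walk_from v s -> walk_from w (rev_steps v s)].
Proof.
elim: s v => [|[e w] s IH] v //=; rewrite rev_steps_cons.
have [H1 H2 H3 H4] := IH w; split.
- by rewrite map_rcons H1 -rev_cons.
- by rewrite map_rcons -rcons_cons H2 -rev_cons.
- by rewrite map_rcons last_rcons.
- by case/andP=> Hj /H4 H; rewrite walk_from_rcons H H3 joinsC.
Qed.

Lemma size_rev_steps v s : size (rev_steps v s) = size s.
Proof. by elim: s v => [|[e w] s IH] v //; rewrite rev_steps_cons size_rcons IH. Qed.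

Lemma mem_split_walk v s z : z \in v :: map snd s ->
  exists p q, s = p ++ q /\ last v (map snd p) = z.
Proof.
elim: s v => [|[e w] s IH] v; rewrite inE.
- by move/eqP->; exists [::], [::].
case/predU1P=> [->|/IH [p [q [-> <-]]]]; first by exists [::], ((e, w) :: s).
by exists ((e, w) :: p), q.
Qed.


Lemma bicycle_walk w s1 p s2 : let W := (w, ((s1 ++ p) ++ s2) ++ rev_steps w p) in
  walk_from w s1 -> last w (map snd s1) = w -> walk_from w p ->
  walk_from (last w (map snd p)) s2 ->
  last (last w (map snd p)) (map snd s2) = last w (map snd p) ->
  is_walk ends W /\ wend W = w.
Proof.
move=> /= H1 E1 Hp H2 E2; have [_ _ E3 H3] := rev_stepsP w p.
rewrite /is_walk /wend /= !walk_from_cat !map_cat !last_cat E1 E2 E3.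
by rewrite H1 Hp H2 H3.
Qed.

(** Each odd cycle flips the colour expected next. After [s1] this makes [p] start with [~~ c];
    after [s2] the expected colour is that of the last edge of [p], so [p] can be retraced. *)
Lemma alt_bicycleI w s1 p s2 c : let z := last w (map snd p) in
  walk_from w s1 -> last w (map snd s1) = w -> odd (size s1) -> uniq (map snd s1) ->
  alternates c (map fst s1) ->
  walk_from w p -> walk_from z s2 -> last z (map snd s2) = z -> odd (size s2) ->
  uniq (map snd s2) -> alternates (~~ c) (map fst (p ++ s2)) ->
  uniq (cyc_int (w, s1) ++ wverts (w, p) ++ cyc_int (z, s2)) ->
  alt_bicycle ends col (w, ((s1 ++ p) ++ s2) ++ rev_steps w p).
Proof.
move=> z H1 E1 odd1 U1 A1 Hp H2 E2 odd2 U2 Ap2 U.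
have [W1 W2] := bicycle_walk H1 E1 Hp H2 E2.
move: (Ap2); rewrite map_cat alternates_cat => /andP[Ap A2].
have Up : uniq (wverts (w, p)) by move: U; rewrite !cat_uniq => /and3P[_ _ /andP[]].
exists (w, s1), (w, p), (z, s2); split; split=> //.
- exact: odd_ia_cycleI H1 E1 odd1 U1 A1.
- exact: odd_ia_cycleI H2 E2 odd2 U2 A2.
- by rewrite /pathw Up andbT /trailw /is_walk Hp (path_uniq_edges Hp).
have /and4P[] // : caw ends col (w, ((s1 ++ p) ++ s2) ++ rev_steps w p).
apply/cawE; split=> //.
- by case: (s1) odd1.
- by rewrite !size_cat size_rev_steps !oddD odd1 odd2 /= addbT negbK addbb.
exists c; rewrite !map_cat !alternates_cat A1 /= !size_cat !size_map odd1 addbT Ap /=.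
rewrite oddD odd1 addTb addbN -addNb; move: A2; rewrite size_map => -> /=.
have [-> _ _ _] := rev_stepsP w p.
have := alternates_rev Ap; congr alternates.
rewrite !oddD odd1 odd2 size_map.
by case: (odd _); case: (c).
Qed.

(** * Alternating cycles and bicycles inside a balanced support *)

Section Support.
(** [S] stands for the support of a cone element; balance enters only through the existence of a
    continuing edge of the other colour. *)
Variable S : pred E.
Hypothesis S_balanced : forall e v, S e -> incident e v ->
  exists f, [/\ S f, incident f v & col f != col e].

(** While the endpoint is new, [S_balanced] supplies a further step; the distinct vertices visited
    cannot outnumber [V], so this stops. The start [v] itself may lie in the obstacle set [A]. *)
Lemma grow_until_hit (A : seq V) e v : S e -> incident e v ->
  exists s f z, [/\ walk_from v (rcons s (f, z)), alternates (col e) (map fst (rcons s (f, z))),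
    all S (map fst (rcons s (f, z))), uniq (v :: map snd s)
    & {in map snd s, forall t, t \notin A}] /\ (z \in A) || (z \in v :: map snd s).
Proof.
move=> Se Iev; have [u Hj] := incident_joins Iev.
have grow n s f z : #|V| <= size s + n ->
    [/\ walk_from v (rcons s (f, z)), alternates (col e) (map fst (rcons s (f, z))),
    all S (map fst (rcons s (f, z))), uniq (v :: map snd s)
    & {in map snd s, forall t, t \notin A}] ->
  exists s f z, [/\ walk_from v (rcons s (f, z)), alternates (col e) (map fst (rcons s (f, z))),
    all S (map fst (rcons s (f, z))), uniq (v :: map snd s)
    & {in map snd s, forall t, t \notin A}] /\ (z \in A) || (z \in v :: map snd s).
  elim: n s f z => [|n IH] s f z Hn [Hw Ha HS Hu HA].
    by have := max_card [in v :: map snd s]; rewrite (card_uniqP Hu) /= size_map leqNgt ltnS -[size s]addn0 Hn.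
  have [Hz|] := boolP ((z \in A) || (z \in v :: map snd s)); first by exists s, f, z.
  rewrite negb_or => /andP[zA zs].
  have Sf : S f by move: HS; rewrite map_rcons all_rcons => /andP[].
  have [||g [Sg Ig cg]] := S_balanced (e := f) (v := z) => //.
    by move: Hw; rewrite walk_from_rcons => /andP[_ /joins_incident->]; rewrite eqxx orbT.
  have [z' Hz'] := incident_joins Ig.
  apply: (IH (rcons s (f, z)) g z'); first by rewrite size_rcons addSnnS.
  split.
  - by rewrite walk_from_rcons Hw map_rcons last_rcons.
  - move: Ha; rewrite !map_rcons [alternates _ (rcons (rcons _ _) _)]alternates_rcons => Ha.
    rewrite Ha /= size_rcons size_map /=; move: Ha cg.
    rewrite alternates_rcons size_map => /andP[_ /eqP->].
    by case: (col g) (col e) (odd _) => [] [] [].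
  - by rewrite map_rcons all_rcons Sg.
  - by rewrite map_rcons -rcons_cons rcons_uniq zs.
  - by move=> t; rewrite map_rcons mem_rcons inE => /predU1P[->|/HA].
apply: (grow #|V| [::] e u); first by rewrite add0n.
by split; rewrite //= ?Hj ?eqxx ?Se.
Qed.

(* The two arcs of the odd cycle s1 between u and w have lengths of opposite
   parity; exactly one of them closes the path p up to an alternating cycle. *)
Lemma theta_cycle w s1 p f u c : walk_from w s1 -> last w (map snd s1) = w -> odd (size s1) ->
  uniq (map snd s1) -> alternates c (map fst s1) -> all S (map fst s1) ->
  walk_from w (rcons p (f, u)) -> alternates (~~ c) (map fst (rcons p (f, u))) ->
  all S (map fst (rcons p (f, u))) ->
  uniq (map snd p) -> {in map snd p, forall t, t \notin map snd s1} ->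
  u \in map snd s1 -> u != w ->
  exists W, alt_cycle ends col W /\ all S (wedges W).
Proof.
move=> H1 E1 odd1 U1 A1 S1 Hp Ap Sp Up Dp us uw.
have close r : walk_from u r -> last u (map snd r) = w ->
    odd (size r) = odd (size (rcons p (f, u))) -> uniq (map snd r) ->
    alternates (~~ c (+) odd (size (rcons p (f, u)))) (map fst r) -> all S (map fst r) ->
    {subset map snd r <= map snd s1} -> u \notin map snd r ->
    exists W, alt_cycle ends col W /\ all S (wedges W).
  move=> Hr Er oddr Ur Ar Sr sub ur; exists (w, rcons p (f, u) ++ r); split.
    apply: (@alt_cycleI _ _ (~~ c)).
    - by rewrite walk_from_cat Hp map_rcons last_rcons.
    - by rewrite map_cat last_cat map_rcons last_rcons.
    - by rewrite size_cat size_rcons.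
    - by rewrite size_cat oddD oddr addbb.
    - rewrite map_cat cat_uniq Ur andbT map_rcons rcons_uniq Up andbT.
      rewrite (contraL (Dp u)) ?us //=.
      apply/hasPn => t /= tr; rewrite mem_rcons inE negb_or (contraNneq _ ur) => [|<- //].
      by apply: contraL (sub _ tr) => /Dp.
    - by rewrite map_cat alternates_cat Ap size_map.
  by rewrite /wedges /= map_cat all_cat Sp.
have [|a [b [Es Ea]]] := @mem_split_walk w s1 u; first by rewrite inE us orbT.
rewrite Es in H1 E1 odd1 U1 A1 S1 close Dp us.
rewrite walk_from_cat Ea in H1; case/andP: H1 => Ha Hb.
rewrite map_cat last_cat Ea in E1.
rewrite map_cat cat_uniq in U1; case/and3P: U1 => Ua Dab Ub.
rewrite map_cat alternates_cat size_map in A1; case/andP: A1 => Aa Ab.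
rewrite map_cat all_cat in S1; case/andP: S1 => Sa Sb.
(* As [u] and [w] differ, neither arc is empty: [a] ends in [u] and [b] in [w]. Since the vertices
   of [s1] are distinct, [u] is not on [b] and [w] is not on [a]. *)
have ua : u \in map snd a.
  by case/lastP: (a) Ea uw => [/= ->|a' [g y]]; rewrite ?eqxx // map_rcons last_rcons mem_rcons => ->; rewrite inE eqxx.
have wb : w \in map snd b.
  by case/lastP: (b) E1 uw => [/= ->|b' [g y]]; rewrite ?eqxx // map_rcons last_rcons mem_rcons => ->; rewrite inE eqxx.
have [par|par] := eqVneq (odd (size b)) (odd (size (rcons p (f, u)))).
  apply: (close b) => //.
  - move: Ab odd1; rewrite -par size_cat oddD.
    by case: (odd (size a)); case: (odd (size b)); case: (c).
  - by move=> t tb; rewrite map_cat mem_cat tb orbT.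
  - by apply/negP => ub; case/hasP: Dab; exists u.
have [R1 R2 R3 R4] := rev_stepsP w a; rewrite Ea in R2 R3 R4.
have RU : uniq (u :: map snd (rev_steps w a)).
  rewrite R2 rev_uniq /= Ua andbT; apply/negP => wa; case/hasP: Dab.
  by exists w.
apply: (close (rev_steps w a)) => //.
- exact: R4.
- move: odd1 par; rewrite size_rev_steps size_cat oddD.
  by case: (odd _); case: (odd _); case: (odd _).
- by case/andP: RU.
- rewrite R1; move: (alternates_rev Aa); congr alternates.
  move: odd1 par; rewrite size_map size_cat oddD.
  by case: (odd _); case: (odd _); case: (odd _); case: (c).
- by rewrite R1 all_rev.
- move=> t tr; have : t \in rev (w :: map snd a) by rewrite -R2 inE tr orbT.
  by rewrite mem_rev inE map_cat mem_cat => /predU1P[->|->]; rewrite ?wb ?orbT.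
- by case/andP: RU.
Qed.

Lemma cycle_or_bicycle_in_support e : S e ->
  exists W, (alt_cycle ends col W \/ alt_bicycle ends col W) /\ all S (wedges W).
Proof.
move=> Se; pose v := (ends e).1.
have Iev : incident e v by rewrite /Defs.incident eqxx.
(* Without obstacles the walk can only run into itself, at [w]; the initial part [a] is dropped and
   the loop at [w] kept. *)
have [s [f [w [[Hw Ha HS Hu _] /= ws]]]] := grow_until_hit [::] Se Iev.
have [a [b [Es Ea]]] := mem_split_walk ws.
rewrite {s}Es rcons_cat in Hw Ha HS Hu ws.
rewrite walk_from_cat Ea in Hw; case/andP: Hw => _ Hb.
rewrite map_cat alternates_cat in Ha; case/andP: Ha => _ Ab.
rewrite map_cat all_cat in HS; case/andP: HS => _ Sb.
set c := _ (+) _ in Ab.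
have Eb : last w (map snd (rcons b (f, w))) = w by rewrite map_rcons last_rcons.
have Ub : uniq (w :: map snd b).
  move: Hu; rewrite map_cat -cat_cons lastI Ea -cats1 -catA cat_uniq => /and3P[_ _].
  by [].
have Ub' : uniq (map snd (rcons b (f, w))) by rewrite map_rcons rcons_uniq.
have [odd1|even1] := boolP (odd (size (rcons b (f, w)))); last first.
  exists (w, rcons b (f, w)); split=> //; left.
  by apply: alt_cycleI Ab; rewrite // size_rcons.
pose s1 := rcons b (f, w); rewrite -/s1 in Hb Ab Sb Eb Ub' odd1.
(* An odd loop begins and ends with the same colour, so the opposite-coloured edge [g] that balance
   provides at [w] has colour [~~ c]. *)
have ec : col f = c.
  move: Ab odd1; rewrite /s1 map_rcons alternates_rcons size_rcons /= size_map => /andP[_ /eqP->] /negbTE->.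
  by rewrite addbF.
have Sf : S f by move: Sb; rewrite /s1 map_rcons all_rcons => /andP[].
have If : incident f w.
  by move: Hb; rewrite /s1 walk_from_rcons => /andP[_ /joins_incident->]; rewrite eqxx orbT.
have [g [Sg Ig cg]] := S_balanced Sf If.
have {cg} cg : col g = ~~ c by rewrite -ec; case: (col g) (col f) cg => [] [].
have [p [h [u [[Hp Ap Sp Up Dp] Du]]]] := grow_until_hit (map snd s1) Sg Ig.
rewrite cg in Ap.
have wmem : w \in map snd s1 by rewrite /s1 map_rcons mem_rcons inE eqxx.
(* Returning to the base [w] counts as the path hitting itself: then [q] is empty and the two cycles
   share their base. Otherwise the path ends on the first loop away from [w]. *)
have [uin|unin] := boolP (u \in w :: map snd p); last first.
  have [W [HW SW]] : exists W, alt_cycle ends col W /\ all S (wedges W).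
    apply: (theta_cycle Hb Eb odd1 Ub' Ab Sb Hp Ap Sp) => //.
    - by case/andP: Up.
    - by move: Du; rewrite (negbTE unin) orbF.
    - by apply: contraNneq unin => ->; rewrite inE eqxx.
  by exists W; split=> //; left.
have [q [r [Ep Eq]]] := mem_split_walk uin.
rewrite {p}Ep rcons_cat in Hp Ap Sp Up Dp uin Du.
rewrite walk_from_cat Eq in Hp; case/andP: Hp => Hq Hr.
set s2 := rcons r (h, u) in Hr Ap Sp.
have Er : last u (map snd s2) = u by rewrite map_rcons last_rcons.
have Ur : uniq (u :: map snd r).
  by move: (Up); rewrite map_cat -cat_cons lastI Eq -cats1 -catA cat_uniq => /and3P[].
have Ur' : uniq (map snd s2) by rewrite map_rcons rcons_uniq.
move: (Ap); rewrite map_cat alternates_cat => /andP[_ Ar].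
move: (Sp); rewrite map_cat all_cat => /andP[Sq Sr].
have [odd2|even2] := boolP (odd (size s2)); last first.
  exists (u, s2); split=> //; left.
  by apply: alt_cycleI Ar; rewrite // size_rcons.
exists (w, ((s1 ++ q) ++ s2) ++ rev_steps w q); split; last first.
  rewrite /wedges /= !map_cat !all_cat Sb Sq Sr /=.
  by have [-> _ _ _] := rev_stepsP w q; rewrite all_rev.
right; apply: (alt_bicycleI (c := c)) => //; rewrite ?Eq //.
have cyc_rcons x t k : cyc_int (x, rcons t (k, x)) = map snd t :> seq V.
  rewrite /cyc_int /wlen /wverts /= size_rcons /= map_rcons -cats1 take_size_cat //.
  by rewrite size_map.
rewrite /s1 /s2 !cyc_rcons /wverts /= -cat_cons cat_uniq.
rewrite cons_uniq in Ub; case/andP: Ub => wb ->; move: Up; rewrite map_cat -cat_cons => ->; rewrite andTb andbT.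
apply/hasPn => t; rewrite inE => /predU1P[->|tqr] //=.
by have := Dp t; rewrite map_cat => /(_ tqr); rewrite /s1 map_rcons mem_rcons inE negb_or => /andP[].
Qed.

End Support.

(** * Splitting into irreducible walks *)

(* Between two traversals of an edge in the same direction an even number of
   steps is made, so the walk can be cut there into two alternating ones. *)
Lemma split_at_repeated_step v s c : walk_from v s -> last v (map snd s) = v ->
  ~~ odd (size s) -> alternates c (map fst s) -> ~~ uniq s ->
  exists W1 W2, [/\ caw ends col W1, caw ends col W2
                  & forall e, chi (v, s) e = chi W1 e + chi W2 e].
Proof.
move=> Hw Hl ev Ha nu.
have [[e w] [a [b [d Es]]]] : exists x a b d, s = a ++ x :: b ++ x :: d.
  elim: (s) nu => //= x r IH; rewrite negb_and negbK => /orP[xr|/IH [y [a [b [d ->]]]]].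
    by case/splitPr: xr => b d; exists x, [::], b, d.
  by exists y, (x :: a), b, d.
rewrite {s nu}Es in Hw Hl ev Ha *.
rewrite walk_from_cat /= walk_from_cat /= in Hw.
case/and3P: Hw => Hw1 Hj /and3P[Hb Hj' Hd].
rewrite map_cat /= map_cat /= last_cat /= last_cat /= in Hl.
move: Ha; rewrite map_cat /= map_cat /= alternates_cat /= alternates_cat /= size_map.
case/and3P=> Aa /eqP ce /and3P[Ab /eqP ce' Ad].
have oddb : odd (size b).
  move: ce'; rewrite ce size_map; case: (odd (size b)) => //.
  by case: (_ (+) _).
move: ev; rewrite size_cat /= size_cat /= addnS !(oddS, oddD) oddb /= => ev.
(* The first walk goes from the first traversal of [e] straight to [d]; the second is the excised
   loop at [w], ending with the second traversal. *)
exists (v, a ++ (e, w) :: d), (w, b ++ [:: (e, w)]); split.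
- apply/cawE; split.
  + by rewrite walk_from_cat /= Hw1 Hj.
  + by rewrite map_cat last_cat.
  + by rewrite size_cat /= addnS.
  + by rewrite size_cat /= oddD /= -(negbK (odd (size d))); move: ev; case: (odd (size a)); case: (odd (size d)).
  + exists c; rewrite map_cat alternates_cat /= Aa size_map ce eqxx /=.
    by move: Ad; rewrite size_map oddb; case: (c (+) _).
- apply/cawE; split.
  + by rewrite walk_from_cat /= Hb Hj'.
  + by rewrite map_cat last_cat.
  + by rewrite size_cat /= addnS.
  + by rewrite size_cat /= addn1 oddS oddb.
  + exists (~~ (c (+) odd (size a))); rewrite map_cat alternates_cat /= Ab size_map ce oddb.
    by case: (c (+) _).
- move=> f; rewrite /chi /wedges /= !map_cat /= !map_cat /= !count_cat /= !count_cat /= addn0.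
  move: (nat_of_bool _) (count _ _) (count _ _) (count _ _) => i j k l.
  by rewrite -!addnA; do 2![congr addn]; rewrite addnA addnC.
Qed.

(** All steps are distinct, since a repeated one would allow a split, and a step along [e] is
    determined by the endpoint it reaches. *)
Lemma irr_caw_chi_le2 W : irr_caw ends col W -> forall e, chi W e <= 2.
Proof.
case: W => v s [/cawE [Hw Hl _ ev [c Ha]] irr] e.
have [Us|/(split_at_repeated_step Hw Hl ev Ha)//] := boolP (uniq s).
have sub : {subset [seq x <- s | x.1 == e] <= [:: (e, (ends e).1); (e, (ends e).2)]}.
  move=> [f w]; rewrite mem_filter /= => /andP[/eqP-> es].
  have : incident e w.
    elim: (s) (v) Hw es => //= [[g y] r IH] u /andP[Hj Hr].
    rewrite inE => /predU1P[[-> ->]|]; last exact: IH Hr.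
    by rewrite (joins_incident _ Hj) eqxx orbT.
  by rewrite /Defs.incident !inE !xpair_eqE eqxx /= ![w == _]eq_sym.
by have := uniq_leq_size (filter_uniq _ Us) sub; rewrite size_filter /chi /wedges count_map.
Qed.

Lemma sum_chi (W : walk V E) : \sum_e chi W e = wlen W.
Proof.
rewrite /chi /wlen -(size_map fst) -/(wedges W).
elim: (wedges W) => [|f l IH] /=; first by rewrite big1.
rewrite big_split /= IH (bigD1 f) //= eqxx big1 ?addn0 // => g /negbTE.
by rewrite eq_sym => ->.
Qed.

(** [P] is later [caw] or [catw]. Lengths add up when characteristic vectors do, by [sum_chi], so
    both parts of a splitting are shorter and induction on length applies. *)
Lemma irreducible_decomposition (P : pred (walk V E)) (W : walk V E) :
  (forall W, P W -> 0 < wlen W) -> P W ->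
  exists l : seq (walk V E),
    (forall W', W' \in l -> P W' /\ ~ exists W1 W2 : walk V E, [/\ P W1, P W2 &
        forall e, chi W' e = chi W1 e + chi W2 e]) /\
    forall e, chi W e = \sum_(W' <- l) chi W' e.
Proof.
move=> P0; move: {2}(wlen W).+1 (ltnSn (wlen W)) => n; elim: n W => // n IH W Wn PW.
have [[W1 [W2 [P1 P2 E12]]]|irr] := EM (exists W1 W2 : walk V E, [/\ P W1, P W2 &
        forall e, chi W e = chi W1 e + chi W2 e]); last first.
  by exists [:: W]; split=> [W'|e]; rewrite ?inE ?big_seq1 // => /eqP->.
have len : wlen W = wlen W1 + wlen W2.
  by rewrite -!sum_chi -big_split; apply: eq_bigr => e _; exact: E12.
have [] := (P0 _ P1, P0 _ P2) => L1 L2.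
have [||l1 [I1 D1]] := IH W1 => //; first by lia.
have [||l2 [I2 D2]] := IH W2 => //; first by lia.
exists (l1 ++ l2); split=> [W'|e]; last by rewrite big_cat /= -D1 -D2.
by rewrite mem_cat => /orP[/I1|/I2].
Qed.

Lemma irreducible_decomposition_seq (P : pred (walk V E)) (l : seq (walk V E)) :
  (forall W, P W -> 0 < wlen W) -> all P l ->
  exists l' : seq (walk V E),
    (forall W', W' \in l' -> P W' /\ ~ exists W1 W2 : walk V E, [/\ P W1, P W2 &
        forall e, chi W' e = chi W1 e + chi W2 e]) /\
    forall e, \sum_(W <- l) chi W e = \sum_(W <- l') chi W e.
Proof.
move=> P0; elim: l => [_|W l IH /= /andP[PW /IH [l' [Hl' El']]]].
  by exists [::]; split.
have [l1 [I1 D1]] := irreducible_decomposition P0 PW.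
exists (l1 ++ l'); split=> [W'|e]; last by rewrite big_cons big_cat /= D1 El'.
by rewrite mem_cat => /orP[/I1|/Hl'].
Qed.

(** An edge has two distinct ends and only one can be the base. This serves to separate the edges of
    a bicycle's cycles from the rest. *)
Lemma cycle_edge_interior v q f e : walk_from v (rcons q (f, v)) ->
  e \in map fst (rcons q (f, v)) -> exists2 t, t \in map snd q & incident e t.
Proof.
move=> Hw He.
have I t : incident e t -> (t == v) || (t \in map snd q).
  by move/(walk_incident Hw He); rewrite map_rcons inE mem_rcons inE orbA orbb.
have I1 : incident e (ends e).1 by rewrite /Defs.incident eqxx.
have I2 : incident e (ends e).2 by rewrite /Defs.incident eqxx orbT.
have := noloop e; case/orP: (I _ I1) => [/eqP E1|]; last by exists (ends e).1.
case/orP: (I _ I2) => [/eqP E2|]; last by exists (ends e).2.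
by rewrite E1 E2 eqxx.
Qed.

(** * Signed incidence sums and integral decomposition *)

Section Imbalance.
Local Open Scope ring_scope.
Variable R : realFieldType.
Implicit Types (x y : E -> R).

Definition csign c : R := if c then 1 else -1.

(** Red minus blue at [v], a linear form in [x]; the cone is cut out of the nonnegative orthant by
    its vanishing at all vertices. *)
Definition imbalance x v : R := \sum_(e | incident e v) csign (col e) * x e.

Lemma csignN c : csign (~~ c) = - csign c.
Proof. by case: c; rewrite /csign /= ?opprK. Qed.

Lemma csign_mul c : csign c * csign c = 1.
Proof. by case: c; rewrite /csign /= ?mulrNN mulr1. Qed.

Lemma csign_neq0 c : csign c != 0.
Proof. by case: c; rewrite /csign ?oppr_eq0 oner_eq0. Qed.

Lemma in_coneE x :
  in_cone ends col x <-> (forall e, 0 <= x e) /\ forall v, imbalance x v = 0.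
Proof.
have Edef v : imbalance x v = \sum_(e | incident e v && col e) x e
                         - \sum_(e | incident e v && ~~ col e) x e.
  rewrite /imbalance (bigID col) /= -sumrN; congr (_ + _); apply: eq_bigr => e /andP[_ ce].
    by rewrite ce mul1r.
  by rewrite (negbTE ce) mulN1r.
split=> -[x0 H]; split=> // v; first by rewrite Edef H subrr.
by apply/eqP; rewrite -subr_eq0 -Edef H.
Qed.

Lemma imbalanceD x y a b v :
  imbalance (fun e => a * x e + b * y e) v = a * imbalance x v + b * imbalance y v.
Proof.
rewrite /imbalance !big_distrr -big_split; apply: eq_bigr => e _ /=.
by rewrite mulrDr !mulrA ![_ * csign _]mulrC.
Qed.

Lemma eq_imbalance x y v : x =1 y -> imbalance x v = imbalance y v.
Proof. by move=> xy; apply: eq_bigr => e _; rewrite xy. Qed.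

(** Consecutive edges have opposite signs and cancel at the vertex between them, leaving the two
    ends. The last sign is that of the colour an edge prolonging the walk would have, hence the
    minus. *)
Lemma imbalance_walk v s c t : walk_from v s -> alternates c (map fst s) ->
  imbalance (fun e => (count_mem e (map fst s))%:R) t =
  csign c * (t == v)%:R - csign (c (+) odd (size s)) * (t == last v (map snd s))%:R.
Proof.
elim: s v c => [|[e w] s IH] v c /=.
  by rewrite addbF subrr => _ _; apply: big1 => e _; rewrite mulr0.
case/andP=> Hj Hw /andP[/eqP ce Ha].
rewrite (_ : imbalance _ t =
    imbalance (fun f => (e == f)%:R) t + imbalance (fun e => (count_mem e (map fst s))%:R) t);
  last first.
  by rewrite /imbalance -big_split; apply: eq_bigr => f _; rewrite natrD mulrDr.
rewrite (IH _ _ Hw Ha) addNb -addbN csignN.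
have -> : imbalance (fun f => (e == f)%:R) t = csign c * ((t == v)%:R + (t == w)%:R).
  rewrite -ce /imbalance big_mkcond (bigD1 e) //= eqxx mulr1 big1 ?addr0 => [|f /negbTE fe].
    have vw := joins_neq Hj.
    rewrite (joins_incident t Hj); case: eqVneq => [->|_] /=.
      by rewrite (negbTE vw) addr0 mulr1.
    by case: eqP; rewrite add0r ?mulr1 ?mulr0.
  by rewrite eq_sym fe mulr0 if_same.
by rewrite mulrDr mulNr addrA addrK.
Qed.

Lemma caw_in_cone W : caw ends col W -> in_cone ends col (fun e => (chi W e)%:R : R).
Proof.
case: W => v s /cawE [Hw Hl _ /negbTE ev [c Ha]]; apply/in_coneE; split=> // t.
by rewrite (imbalance_walk t Hw Ha) Hl ev addbF subrr.
Qed.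

Lemma edge_of_imbalance y v c : (forall e, 0 <= y e) -> 0 < csign c * imbalance y v ->
  exists f, [/\ incident f v, col f = c & 0 < y f].
Proof.
move=> y0 H; have [/existsP[f /and3P[If /eqP cf yf]]|] :=
  boolP [exists f, [&& incident f v, col f == c & 0 < y f]]; first by exists f.
rewrite negb_exists => /forallP none; move: H; rewrite ltNge => /negP[].
rewrite big_distrr; apply: sumr_le0 => f If; have := none f; rewrite If /=.
case: eqVneq => [->|cf] /=; first by rewrite -leNgt mulrA csign_mul mul1r.
move=> _; rewrite mulrA (_ : col f = ~~ c) ?csignN ?mulrN ?csign_mul ?mulN1r ?oppr_le0 //.
by case: (col f) (c) cf => [] [].
Qed.

(** Setting [x e] to zero tips the balance at [v] towards the other colour, and [edge_of_imbalance]
    then finds [f]. This provides [S_balanced] for supports. *)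
Lemma cone_support_balanced x : in_cone ends col x ->
  forall e v, x e != 0 -> incident e v ->
  exists f, [/\ x f != 0, incident f v & col f != col e].
Proof.
move=> /in_coneE[x0 H] e v xe Ie.
pose y f := if f == e then 0 else x f.
have [||f [If cf yf]] := @edge_of_imbalance y v (~~ col e).
- by move=> f; rewrite /y; case: ifP.
- have := H v; rewrite /imbalance (bigD1 e) //= => /eqP; rewrite addrC addr_eq0 => /eqP Hs.
  rewrite (bigD1 e) //= {1}/y eqxx mulr0 add0r (eq_bigr (fun f => csign (col f) * x f)).
    by rewrite Hs csignN mulrNN mulrA csign_mul mul1r lt_neqAle eq_sym xe x0.
  by move=> f /andP[_ /negbTE fe]; rewrite /y fe.
exists f; rewrite If cf; split=> //; last by case: (col e).
by move: yf; rewrite /y; case: ifP => [_|_ /lt0r_neq0 //]; rewrite ltxx.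
Qed.

(* Unless it already closes up with even length, an alternating walk below x
   leaves x - chi W unbalanced at its end, in favour of the colour needed to
   prolong it. *)
Lemma exists_caw_below (x : E -> nat) e : (forall v, imbalance (fun e => (x e)%:R) v = 0) ->
  (0 < x e)%N -> exists W, caw ends col W /\ forall e, (chi W e <= x e)%N.
Proof.
move=> Hx xe; pose v := (ends e).1; pose c := col e.
have Iev : incident e v by rewrite /Defs.incident eqxx.
have [w Hj] := incident_joins Iev.
have step s : walk_from v s -> alternates c (map fst s) ->
    (forall e, (chi (v, s) e <= x e)%N) -> ~~ ((last v (map snd s) == v) && ~~ odd (size s)) ->
    exists f, [/\ incident f (last v (map snd s)), col f = c (+) odd (size s)
                & (chi (v, s) f < x f)%N].
  move=> Hw Ha Hc Hopen; set u := last v (map snd s) in Hopen *.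
  have [f||f [If cf]] := @edge_of_imbalance (fun e => (x e)%:R - (chi (v, s) e)%:R) u
    (c (+) odd (size s)); first by rewrite subr_ge0 ler_nat.
    rewrite (eq_imbalance (y := fun e => 1 * (x e)%:R + -1 * (chi (v, s) e)%:R)) => [|f];
      last by rewrite mul1r mulN1r.
    rewrite imbalanceD Hx (imbalance_walk u Hw Ha) mulr0 add0r -/u eqxx mulN1r opprB mulr1.
    (* If the walk is back at [v], its length is odd and its two ends contribute there with the same
       sign, so nothing cancels. *)
    case: eqVneq Hopen => /= [_|_ _]; last by rewrite mulr0 subr0 csign_mul ltr01.
    rewrite negbK => ->; rewrite addbT csignN mulr1 -opprD mulrNN mulrDr csign_mul.
    by rewrite addr_gt0.
  by rewrite subr_gt0 ltr_nat => xf; exists f.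
have grow n s : (\sum_e x e <= size s + n)%N -> (0 < size s)%N -> walk_from v s ->
    alternates c (map fst s) -> (forall e, (chi (v, s) e <= x e)%N) ->
    exists W, caw ends col W /\ forall e, (chi W e <= x e)%N.
  elim: n s => [|n IH] s Hn s0 Hw Ha Hc;
    (have [/andP[/eqP uv ev]|/(step s Hw Ha Hc) [f [If cf xf]]] :=
       boolP ((last v (map snd s) == v) && ~~ odd (size s));
       first by exists (v, s); split=> //; apply/cawE; split=> //; exists c).
    (* The walk stays below [x], strictly so at [f], hence is shorter than the total of [x]: the
       fuel cannot have run out. *)
    move: Hn; rewrite addn0 leqNgt; case/negP.
    rewrite -[X in (X < _)%N]/(wlen (v, s)) -sum_chi (bigD1 f) //= [X in (_ < X)%N](bigD1 f) //= -addSn.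
    by apply: leq_add => //; apply: leq_sum.
  have [z Hz] := incident_joins If.
  apply: (IH (rcons s (f, z))).
  - by rewrite size_rcons addSnnS.
  - by rewrite size_rcons.
  - by rewrite walk_from_rcons Hw.
  - by rewrite map_rcons alternates_rcons Ha size_map cf eqxx.
  - move=> g; rewrite /chi /wedges /= map_rcons -cats1 count_cat /= addn0.
    by case: eqVneq => [<-|_]; rewrite ?addn1 // addn0; apply: Hc.
apply: (grow (\sum_e x e)%N [:: (e, w)]) => //=.
- by rewrite Hj.
- by rewrite eqxx.
- by move=> f; rewrite /chi /= addn0; case: eqVneq => [<-|].
Qed.

(** Peeling off a CAW below [x] preserves balance and lowers the total of [x] by the positive length
    of the walk. *)
Lemma caw_decomposition (x : E -> nat) : (forall v, imbalance (fun e => (x e)%:R) v = 0) ->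
  exists l : seq (walk V E), all (caw ends col) l /\ forall e, x e = (\sum_(W <- l) chi W e)%N.
Proof.
move: {2}(\sum_e x e)%N.+1 (ltnSn (\sum_e x e)%N) => n.
elim: n x => // n IH x Hn Hx.
have [/forallP x0|] := boolP [forall e, x e == 0%N].
  by exists [::]; split=> // e; rewrite big_nil; apply/eqP.
rewrite negb_forall => /existsP[e]; rewrite -lt0n => xe.
have [W [cW leW]] := exists_caw_below Hx xe.
have [|v|l [Hl El]] := IH (fun e => x e - chi W e)%N.
- have : (\sum_e x e = \sum_e (x e - chi W e) + wlen W)%N.
    by rewrite -sum_chi -big_split; apply: eq_bigr => f _ /=; rewrite subnK.
  by have /and4P[_ _ W0 _] := cW; lia.
- rewrite (eq_imbalance (y := fun e => 1 * (x e)%:R + -1 * (chi W e)%:R)) => [|f].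
    by rewrite imbalanceD Hx; have /in_coneE[_ ->] := caw_in_cone cW; rewrite !mulr0 addr0.
  by rewrite natrB // mul1r mulN1r.
exists (W :: l); split=> [|f]; first by rewrite /= cW.
by rewrite big_cons -El subnKC.
Qed.

(** * Rigidity of alternating cycles and bicycles *)

Lemma two_edges y e f w : imbalance y w = 0 -> incident e w -> incident f w ->
  col f = ~~ col e -> (forall g, incident g w -> g != e -> g != f -> y g = 0) -> y e = y f.
Proof.
move=> H Ie If cf H0.
have fe : f != e by apply/eqP => fe; move: cf; rewrite fe; case: (col e).
move: H; rewrite /imbalance (bigD1 e) //= (bigD1 f) /=; last by rewrite If.
rewrite big1 => [|g /andP[/andP[Ig ge] gf]]; last by rewrite H0 ?mulr0.
move/eqP; rewrite addr0 cf csignN mulNr subr_eq0 => /eqP.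
exact/mulfI/csign_neq0.
Qed.

(** At an interior vertex only two consecutive edges of opposite colours can carry [y], so
    [two_edges] passes the value along. The ends [v] and [z] are exempt and may coincide, which
    covers both paths and cycles cut open at the base. *)
Lemma constant_on_segment y v s f z c : walk_from v (rcons s (f, z)) ->
  alternates c (map fst (rcons s (f, z))) -> uniq (v :: map snd s) -> z \notin map snd s ->
  {in map snd s, forall t, imbalance y t = 0} ->
  {in map snd s, forall t g, incident g t -> y g != 0 -> g \in map fst (rcons s (f, z))} ->
  exists a, {in map fst (rcons s (f, z)), forall e, y e = a}.
Proof.
elim: s v c => [|[e w] s IH] v c.
  by move=> _ _ _ _ _ _; exists (y f) => e /=; rewrite inE => /eqP->.
rewrite rcons_cons => /= /andP[Hj Hw] /andP[/eqP ce Ha] /andP[vs Us] zs Himb Hsupp.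
have [|||a Ea] := IH _ _ Hw Ha Us.
- by apply: contra zs; rewrite inE orbC => ->.
- by move=> t ts; apply: Himb; rewrite inE ts orbT.
- move=> t ts g Ig yg; have := Hsupp t; rewrite inE ts orbT => /(_ isT _ Ig yg).
  rewrite inE => /predU1P[ge|//]; move: Ig; rewrite ge (joins_incident _ Hj).
  case/orP=> /eqP tE; rewrite tE in ts; first by move: vs; rewrite inE ts orbT.
  by case/andP: Us; rewrite ts.
exists a => g; rewrite inE => /predU1P[{g}->|/Ea//].
have zw : z != w by apply: contraNneq zs => ->; rewrite inE eqxx.
have wr : w \notin map snd (rcons s (f, z)).
  by rewrite map_rcons mem_rcons inE negb_or eq_sym zw; case/andP: Us.
case Er : (rcons s (f, z)) => [|[g u] r]; first by case: (s) Er.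
rewrite Er /= in Hw Ha Ea Hsupp wr.
rewrite -(Ea g) ?inE ?eqxx //; apply: (@two_edges _ _ _ w).
- by apply: Himb; rewrite inE eqxx.
- by rewrite (joins_incident _ Hj) eqxx orbT.
- by case/andP: Hw => /joins_incident->; rewrite eqxx.
- by case/andP: Ha => /eqP->; rewrite ce.
move=> h Ih he hg; apply/eqP/contraT => yh.
have := Hsupp w; rewrite inE eqxx => /(_ isT h Ih yh); rewrite !inE (negbTE he) (negbTE hg) /= => hr.
by case/andP: Hw => _ Hr; move: wr; rewrite (walk_incident Hr hr Ih).
Qed.

(** The balanced vectors carried by [W] are multiples of its characteristic vector; [y] may have any
    signs. *)
Definition rigid (W : walk V E) := forall y, (forall v, imbalance y v = 0) ->
  (forall e, y e != 0 -> e \in wedges W) -> exists a, forall e, y e = a * (chi W e)%:R.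

Lemma alt_cycle_caw W : alt_cycle ends col W -> caw ends col W.
Proof.
by case/and3P=> /and5P[Hw Hc W0 _ _] _ Ha; rewrite /caw Hw Hc W0 Ha.
Qed.

Lemma alt_bicycle_caw W : alt_bicycle ends col W -> caw ends col W.
Proof.
case=> -[v s1] [[v' p] [[z s2] [[H1 H2 Hp] [/= vE Ez _ -> Ha]]]]; subst v'.
have /andP[/and5P[Hw1 /eqP E1 L1 _ _] _] := H1.
have /andP[/and5P[Hw2 /eqP E2 _ _ _] _] := H2.
have /andP[/andP[Hwp _] _] := Hp.
rewrite /wend /= in Ez E1 E2; rewrite -Ez in E2; rewrite /is_walk /= -Ez in Hw2.
have [W1 W2] := bicycle_walk Hw1 E1 Hwp Hw2 E2.
rewrite /caw; apply/and4P; split=> //; first exact/eqP.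
by rewrite /wlen /= !size_cat; case: (s1) L1.
Qed.

Lemma rigid_alt_cycle W : alt_cycle ends col W -> rigid W.
Proof.
move=> HW y Hy Sy; have := alt_cycle_caw HW; case: W HW Sy => v s HW Sy.
case/cawE=> Hw _ _ _ [c Ha].
have /and3P[/cyclew_rcons[q [e [Es _ Ue Uq _]]] _ _] := HW; rewrite Es in Hw Ha Ue Sy *.
have [|t _|t _ g _ /Sy//|a Ha'] := @constant_on_segment y _ _ _ _ _ Hw Ha Uq.
- by case/andP: Uq.
- exact: Hy.
exists a => f; rewrite /chi /wedges count_uniq_mem //=.
case: (boolP (f \in _)) => [/Ha'->|nf]; first by rewrite mulr1.
by rewrite mulr0; apply/eqP; apply: contraR nf => /Sy.
Qed.

Lemma rigid_alt_bicycle W : alt_bicycle ends col W -> rigid W.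
Proof.
move=> HW y Hy; have := alt_bicycle_caw HW.
case: HW => -[v s1] [[v' p] [[z s2] [[H1 H2 Hp] [/= vE Ez U -> _]]]]; subst v'.
case/cawE=> _ _ _ _ [c HA].
have /and3P[/cyclew_rcons[q1 [e1 [Es1 Hw1 U1 Uq1 Eq1]]] odd1 _] := H1.
have /and3P[/cyclew_rcons[q2 [e2 [Es2 Hw2 U2 Uq2 Eq2]]] odd2 _] := H2.
have /andP[/andP[Hwp Ue] Uv] := Hp; rewrite /is_walk /= in Hwp.
rewrite /wend /= in Ez; rewrite /wlen /= in odd1 odd2.
rewrite Eq1 Eq2 in U; rewrite /wverts /= in U; rewrite /wedges /= in Ue.
have {}Uv : uniq (v :: map snd p) by [].
have [RE _ _ _] := rev_stepsP v p.
move: HA; rewrite !map_cat !alternates_cat => /andP[/andP[/andP[A1 Ap] A2] _].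
rewrite !size_cat !size_map oddD odd1 addbT in Ap A2; rewrite addTb addbN -addNb in A2.
set l1 := map fst s1 in U1 A1 *; set lp := map fst p in Ap Ue *; set l2 := map fst s2 in U2 A2 *.
(* The connecting path is walked in both directions, so its edges count twice. *)
have chiE e : chi (v, ((s1 ++ p) ++ s2) ++ rev_steps v p) e =
    (count_mem e l1 + (count_mem e lp).*2 + count_mem e l2)%N.
  by rewrite /chi /wedges /= !map_cat !count_cat RE count_rev -addnn addnA [RHS]addnAC.
move=> Sy; have {}Sy e : y e != 0 -> [|| e \in l1, e \in lp | e \in l2].
  by move/Sy; rewrite /wedges /= !map_cat !mem_cat RE mem_rev -/l1 -/lp -/l2; do 3!case: (e \in _).
have zp : z \in v :: map snd p by rewrite -Ez mem_last.
move: U; rewrite -cat_cons cat_uniq => /and3P[_ /hasPn D1 U'].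
have {D1}D1 t : t \in (v :: map snd p) ++ map snd q2 -> t \notin map snd q1 by apply: D1.
move: U'; rewrite cat_uniq => /and3P[_ /hasPn D2 _].
have V1 e t : e \in l1 -> incident e t -> (t == v) || (t \in map snd q1).
  move=> He /(walk_incident Hw1 He).
  by rewrite Es1 map_rcons inE mem_rcons inE orbA orbb.
have V2 e t : e \in l2 -> incident e t -> (t == z) || (t \in map snd q2).
  move=> He /(walk_incident Hw2 He).
  by rewrite Es2 map_rcons inE mem_rcons inE orbA orbb.
have Vp e t : e \in lp -> incident e t -> t \in v :: map snd p by apply: walk_incident.
have I1 t g : t \in map snd q1 -> incident g t -> (g \notin lp) && (g \notin l2).
  move=> tq Ig; apply/andP; split; apply/negP => /[dup] Hg.
    by move=> /Vp/(_ Ig) tp; move: (D1 t); rewrite mem_cat tp tq => /(_ isT).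
  move=> /V2/(_ Ig) /orP[/eqP tz|tq2].
    by move: (D1 t); rewrite mem_cat tz zp -tz tq => /(_ isT).
  by move: (D1 t); rewrite mem_cat tq tq2 orbT => /(_ isT).
have I2 t g : t \in map snd q2 -> incident g t -> (g \notin lp) && (g \notin l1).
  move=> tq Ig; apply/andP; split; apply/negP => /[dup] Hg.
    by move=> /Vp/(_ Ig) tp; move: (D2 t tq); rewrite tp.
  move=> /V1/(_ Ig) /orP[/eqP tv|tq1].
    by move: (D2 t tq); rewrite tv inE eqxx.
  by move: (D1 t); rewrite mem_cat tq tq1 orbT => /(_ isT).
have [a1 C1] : exists a, {in l1, forall e, y e = a}.
  rewrite /l1 Es1 in Hw1 A1 I1 Sy *; apply: (constant_on_segment Hw1 A1 Uq1) => [|t _|t tq g Ig].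
  - by case/andP: Uq1.
  - exact: Hy.
  - by case/andP: (I1 t g tq Ig) => /negbTE np /negbTE n2 /Sy; rewrite np n2 !orbF.
have [a2 C2] : exists a, {in l2, forall e, y e = a}.
  rewrite /l2 Es2 in Hw2 A2 I2 Sy *; apply: (constant_on_segment Hw2 A2 Uq2) => [|t _|t tq g Ig].
  - by case/andP: Uq2.
  - exact: Hy.
  - by case/andP: (I2 t g tq Ig) => /negbTE np /negbTE n2 /Sy; rewrite np n2.
(* On an empty path any value would do, and 0 is taken. *)
have [b Cp] : exists b, {in lp, forall e, y e = b}.
  case/lastP Ep : p => [|p' [g z']]; first by exists 0 => e; rewrite /lp Ep.
  rewrite /lp Ep in Hwp Ap Ue Uv Ez Sy Vp D1 D2 *.
  rewrite map_rcons last_rcons /= in Ez; rewrite Ez in Hwp Uv Ap Sy Ue Vp D1 D2 *.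
  move: (Uv); rewrite map_rcons -rcons_cons rcons_uniq => /andP[zp' Uvp].
  apply: (constant_on_segment Hwp Ap Uvp) => [|t _|t tp h Ih].
  - by apply: contra zp'; rewrite inE orbC => ->.
  - exact: Hy.
  have tp' : t \in v :: map snd (rcons p' (g, z)).
    by rewrite map_rcons inE mem_rcons inE tp !orbT.
  case/Sy/or3P=> // [/V1/(_ Ih)|/V2/(_ Ih)] /orP[/eqP tE|tq].
  - by move: Uvp; rewrite -tE /= tp.
  - by move: (D1 t); rewrite mem_cat tp' tq => /(_ isT).
  - by move: zp'; rewrite -tE inE tp orbT.
  - by move: (D2 t tq); rewrite tp'.
have E1 e : e \in l1 -> (e \notin lp) && (e \notin l2).
  by move=> He; have [||t tq It] := @cycle_edge_interior v q1 e1 e; rewrite -?Es1 //; apply: I1 It.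
have E2 e : e \in l2 -> (e \notin lp) && (e \notin l1).
  by move=> He; have [||t tq It] := @cycle_edge_interior z q2 e2 e; rewrite -?Es2 //; apply: I2 It.
have yE e : y e = a1 * (count_mem e l1)%:R + b * (count_mem e lp)%:R + a2 * (count_mem e l2)%:R.
  rewrite !count_uniq_mem //.
  have [h1|n1] := boolP (e \in l1).
    by case/andP: (E1 e h1) => /negbTE-> /negbTE->; rewrite (C1 e h1) !mulr0 mulr1 !addr0.
  have [h2|n2] := boolP (e \in l2).
    by case/andP: (E2 e h2) => /negbTE-> _; rewrite (C2 e h2) !mulr0 mulr1 !add0r.
  have [hp|np] := boolP (e \in lp); first by rewrite (Cp e hp) !mulr0 mulr1 addr0 add0r.
  rewrite !mulr0 !addr0; apply/eqP; apply: contraT => /Sy.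
  by rewrite (negbTE n1) (negbTE n2) (negbTE np).
(* Balance at [t], read off from [imbalance_walk]: an odd cycle meets its base with two edges of one
   colour, a nonempty path meets it with one edge of the other. For an empty path the two path terms
   cancel. *)
have base t : a1 * (csign c * (t == v)%:R + csign c * (t == v)%:R)
    + b * (csign (~~ c (+) odd (size p)) * (t == z)%:R + csign c * (t == v)%:R) * -1
    + a2 * (csign (~~ c (+) odd (size p)) * (t == z)%:R
            + csign (~~ c (+) odd (size p)) * (t == z)%:R) = 0.
  have := Hy t; rewrite (eq_imbalance (y := fun e => 1 * (a1 * (count_mem e l1)%:R
      + b * (count_mem e lp)%:R) + a2 * (count_mem e l2)%:R)) => [|e]; last by rewrite mul1r yE.
  rewrite imbalanceD imbalanceD (imbalance_walk t Hw1 A1) (imbalance_walk t Hwp Ap).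
  rewrite (imbalance_walk t Hw2 A2) odd1 odd2 !addbT !csignN.
  have /and5P[_ /eqP L1 _ _ _] : cyclew ends (v, s1) by case/and3P: H1.
  have /and5P[_ /eqP L2 _ _ _] : cyclew ends (z, s2) by case/and3P: H2.
  rewrite /wend /= in L1 L2; rewrite L1 L2 Ez => <-.
  by ring.
have [/eqP p0|pN] := boolP (p == [::]).
  have zv : z = v by rewrite -Ez p0.
  have lp0 : lp = [::] by rewrite /lp p0.
  have B := base v; rewrite zv p0 /= addbF csignN eqxx !mulr1 in B.
  have a12 : a1 = a2 by apply: (mulIf (csign_neq0 c)); lra.
  by exists a1 => e; rewrite [chi _ _]chiE yE lp0 /= addn0 natrD -a12; ring.
have vz : v != z.
  case/lastP: (p) pN Ez Uv => // p' [g z'] _; rewrite map_rcons last_rcons => /= ->.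
  by rewrite mem_rcons inE negb_or => /andP[/andP[]].
have b1 : b = 2 * a1.
  have := base v; rewrite (negbTE vz) eqxx !(mulr1, mulr0) => B.
  by apply: (mulIf (csign_neq0 c)); lra.
have b2 : b = 2 * a2.
  have := base z; rewrite eq_sym (negbTE vz) eqxx !(mulr1, mulr0) => B.
  by apply: (mulIf (csign_neq0 (~~ c (+) odd (size p)))); lra.
have a12 : a1 = a2 by lra.
by exists a1 => e; rewrite [chi _ _]chiE yE -muln2 !natrD natrM b1 -a12; ring.
Qed.


(** * Extreme rays *)

Lemma caw_chi_neq0 W : caw ends col W -> exists2 e, e \in wedges W & (0 < chi W e)%N.
Proof.
case: W => v [|[e w] s] /and4P[_ _ // _ _].
by exists e; rewrite /chi /wedges /= ?inE eqxx.
Qed.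

(** A cone summand of [x] vanishes wherever [x] does, by nonnegativity, so it is carried by [W] and
    rigidity makes it a multiple of [chi W]. *)
Lemma rigid_extreme W x l : caw ends col W -> rigid W -> 0 < l ->
  (forall e, x e = l * (chi W e)%:R) -> extreme_gen ends col x.
Proof.
move=> cW rW l0 Ex; have [c0 H0] := (in_coneE _).1 (caw_in_cone cW).
have [e He We] := caw_chi_neq0 cW.
split.
- apply/in_coneE; split=> [f|v]; first by rewrite Ex mulr_ge0 // ltW.
  rewrite (eq_imbalance (y := fun e => l * (chi W e)%:R + 0 * 0)) => [|f].
    by rewrite imbalanceD H0 mulr0 mul0r addr0.
  by rewrite Ex mul0r addr0.
- by exists e; rewrite Ex mulf_neq0 ?gt_eqF // ltr0n.
move=> y z /in_coneE[y0 Hy] /in_coneE[z0 _] Eyz.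
have [f yf|a Ea] := rW y Hy.
  have : x f != 0 by rewrite gt_eqF // Eyz ltr_wpDr // lt_neqAle eq_sym yf y0.
  rewrite Ex mulf_eq0 negb_or pnatr_eq0 => /andP[_].
  by rewrite -lt0n /chi -has_count has_pred1.
have a0 : 0 <= a by rewrite -(pmulr_lge0 (x := (chi W e)%:R)) ?ltr0n // -Ea.
exists (a / l) => [|f]; first by rewrite divr_ge0 // ltW.
by rewrite Ex Ea mulrA divfK // gt_eqF.
Qed.

Lemma positive_lower_bound x (s : seq E) : {in s, forall e, 0 < x e} ->
  exists2 l, 0 < l & {in s, forall e, l <= x e}.
Proof.
elim: s => [_|e s IH H]; first by exists 1; rewrite ?ltr01.
have [f fs|l l0 Hl] := IH; first by apply: H; rewrite inE fs orbT.
exists (Num.min l (x e)) => [|f]; first by rewrite lt_min l0 H ?inE ?eqxx.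
by rewrite inE ge_min => /predU1P[->|/Hl->]; rewrite ?lexx ?orbT.
Qed.

Lemma extreme_support x W : extreme_gen ends col x -> caw ends col W ->
  {in wedges W, forall e, x e != 0} ->
  exists2 l, 0 < l & forall e, x e = l * (chi W e)%:R.
Proof.
move=> [/in_coneE[x0 Hx] _ Hext] cW Wx; have [c0 H0] := (in_coneE _).1 (caw_in_cone cW).
have [e He We] := caw_chi_neq0 cW.
have [f /Wx xf|m m0 Hm] := @positive_lower_bound x (wedges W).
  by rewrite lt_neqAle eq_sym xf x0.
(* [m] bounds [x] from below on [W] and [n] bounds [chi W] from above, so subtracting [l] times
   [chi W] keeps [x] nonnegative. *)
pose n : R := (wlen W)%:R; pose l := m / n.
have chin f : (chi W f)%:R <= n by rewrite ler_nat -sum_chi (bigD1 f) //= leq_addr.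
have n0 : 0 < n by apply: lt_le_trans (chin e); rewrite ltr0n.
have l0 : 0 < l by rewrite divr_gt0.
have [|||a a0 Ea] := Hext (fun f => l * (chi W f)%:R) (fun f => x f - l * (chi W f)%:R).
- apply/in_coneE; split=> [f|v]; first by rewrite mulr_ge0 // ltW.
  rewrite (eq_imbalance (y := fun e => l * (chi W e)%:R + 0 * 0)) => [|f].
    by rewrite imbalanceD H0 mulr0 mul0r addr0.
  by rewrite mul0r addr0.
- apply/in_coneE; split=> [f|v].
    rewrite subr_ge0; have [/Hm|nf] := boolP (f \in wedges W).
      by apply: le_trans; rewrite /l mulrAC ler_pdivrMr // ler_pM2l.
    by rewrite /chi (count_memPn nf) mulr0.
  rewrite (eq_imbalance (y := fun e => 1 * x e + (- l) * (chi W e)%:R)) => [|f].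
    by rewrite imbalanceD H0 Hx !mulr0 addr0.
  by rewrite mul1r mulNr.
- by move=> f; rewrite addrC subrK.
have an : a != 0.
  apply/eqP => az; have := Ea e; rewrite az mul0r => /eqP; apply/negP.
  by rewrite mulf_neq0 ?gt_eqF // ltr0n.
exists (l / a) => [|f]; first by rewrite divr_gt0 // lt_neqAle eq_sym an.
by rewrite mulrAC Ea mulrC mulKf.
Qed.

Lemma irr_caw_decomposition (x : E -> nat) : (forall v, imbalance (fun e => (x e)%:R) v = 0) ->
  exists l : seq (walk V E), (forall W, W \in l -> irr_caw ends col W) /\
    forall e, x e = (\sum_(W <- l) chi W e)%N.
Proof.
move/caw_decomposition=> [l [Hl El]].
have [|l' [Hl' El']] := irreducible_decomposition_seq _ Hl; first by move=> W /and4P[].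
by exists l'; split=> // e; rewrite El El'.
Qed.

(** In a sum with values 0 and 1 each CAW passes each edge at most once, so the summands are already
    trails. *)
Lemma irr_cat_decomposition (x : E -> bool) :
  (forall v, imbalance (fun e => (x e : nat)%:R) v = 0) ->
  exists l : seq (walk V E), (forall W, W \in l -> irr_cat ends col W) /\
    forall e, (x e : nat) = (\sum_(W <- l) chi W e)%N.
Proof.
move/caw_decomposition=> [l [Hl El]].
have {}Hl : all (catw ends col) l.
  apply/allP => W Wl; rewrite /catw (allP Hl W Wl) /=.
  apply/count_mem_uniq => e; rewrite -[LHS]/(chi W e).
  have : (chi W e <= 1)%N.
    apply: leq_trans (leq_b1 (x e)); rewrite El (big_rem W) //= leq_addr //.
  rewrite -has_pred1 has_count -[count _ _]/(chi W e).
  by case: (chi W e) => [|[]].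
have [|l' [Hl' El']] := irreducible_decomposition_seq _ Hl; first by move=> W /andP[/and4P[]].
by exists l'; split=> // e; rewrite El El'.
Qed.

End Imbalance.
End Walks.

Local Open Scope ring_scope.

Theorem theorem2p2 (R : realType) (V E : finType) (ends : E -> V * V)
    (col : E -> bool) (noloop : forall e, (ends e).1 != (ends e).2) :
  [/\ (* (i) *)
      (forall x : E -> R, extreme_gen ends col x <->
         exists W : walk V E, (alt_cycle ends col W \/ alt_bicycle ends col W) /\
           exists2 l : R, 0 < l & forall e, x e = l * (chi W e)%:R),
      (* (ii) *)
      (forall x : E -> int, in_cone ends col (fun e => (x e)%:~R : R) ->
         exists cs : seq (nat * walk V E),
           (forall p, p \in cs -> irr_caw ends col p.2) /\
           forall e, x e = (\sum_(p <- cs) p.1 * chi p.2 e)%N%:Z),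
      (* (iii) *)
      (forall x : E -> bool, in_cone ends col (fun e => (x e)%:R : R) ->
         exists cs : seq (nat * walk V E),
           (forall p, p \in cs -> irr_cat ends col p.2) /\
           forall e, (x e : nat) = (\sum_(p <- cs) p.1 * chi p.2 e)%N)
    & (* (iv) *)
      (forall W : walk V E, irr_caw ends col W -> forall e, (chi W e <= 2)%N)].
Proof.
split.
- move=> x; split=> [ex|[W [HW [l l0 Ex]]]].
    have [xc [e xe] _] := ex.
    have [W [HW SW]] := cycle_or_bicycle_in_support (cone_support_balanced xc) xe.
    have cW : caw ends col W by case: HW => [/alt_cycle_caw|/alt_bicycle_caw].
    by exists W; split=> //; apply: extreme_support ex cW (allP SW).
  case: HW => HW; first exact: rigid_extreme (alt_cycle_caw HW) (rigid_alt_cycle HW) l0 Ex.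
  exact: rigid_extreme (alt_bicycle_caw HW) (rigid_alt_bicycle noloop HW) l0 Ex.
- move=> x /in_coneE[x0 Hx].
  have Ex e : x e = `|x e|%N by rewrite gez0_abs // -(ler0z R).
  have [|l [Hl El]] := @irr_caw_decomposition _ _ ends col noloop R (fun e => `|x e|%N).
    by move=> v; rewrite -[RHS](Hx v); apply: eq_imbalance => e; rewrite [in RHS]Ex.
  (* Multiplicities are expressed by repetition in [l], so all coefficients are 1. *)
  exists [seq (1%N, W) | W <- l]; split=> [p /mapP[W /Hl HW ->] //|e].
  by rewrite Ex El big_map; congr Posz; apply: eq_bigr => W _; rewrite mul1n.
- move=> x /in_coneE[_ Hx]; have [l [Hl El]] := irr_cat_decomposition noloop Hx.
  exists [seq (1%N, W) | W <- l]; split=> [p /mapP[W /Hl HW ->] //|e].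
  by rewrite El big_map; apply: eq_bigr => W _; rewrite mul1n.
- exact: irr_caw_chi_le2.
Qed.
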